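(* Let $b=2^{2^s}$ with $s\geq 0$ an integer. Then $\mathfrak{S}_b(n)=\mathfrak{S}_b(n+b)$ for every positive integer $n$.
   Context: For an integer $b\geq 2$ and a positive integer $n$, $L_b(n)\in\{1,\dots,b-1\}$ denotes the last non-zero digit of $n$ in base $b$; that is, writing $n=b^r n'$ with $r\geq 0$ and $b\nmid n'$, $L_b(n)$ is the residue of $n'$ modulo $b$. Define $\mathfrak{S}_b(n):=L_b(n^n)$. *)

(* Defs.v *)
From mathcomp Require Import all_boot.

Set Implicit Arguments.
Unset Strict Implicit.
Unset Printing Implicit Defensive.

(* The exponent r in n = b ^ r * n' with b not dividing n'. (The library's
   [logn b n] is 0 when b is not prime.) The bound k <= n loses nothing for
   1 < b and 0 < n, since then b ^ k %| n implies k < b ^ k <= n. *)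
Definition base_val (b n : nat) : nat := \max_(k < n.+1 | b ^ k %| n) k.

(* Meaningful for 1 < b and 0 < n; see [last_nz_digitE]. *)
Definition last_nz_digit (b n : nat) : nat := (n %/ b ^ base_val b n) %% b.

Definition frakS (b n : nat) : nat := last_nz_digit b (n ^ n).

Lemma base_valE (b r m : nat) :
  1 < b -> ~~ (b %| m) -> base_val b (b ^ r * m) = r.
Proof.
move=> b1 ndv; have b0 : 0 < b by apply: ltnW.
have m0 : 0 < m by case: m ndv; rewrite ?dvdn0.
apply/eqP; rewrite eqn_leq; apply/andP; split.
  apply/bigmax_leqP => k kdv; rewrite leqNgt; apply/negP => rk.
  move/negP: ndv; apply.
  have: b ^ r.+1 %| b ^ r * m by apply: dvdn_trans kdv; apply: dvdn_exp2l.
  by rewrite expnSr dvdn_pmul2l // expn_gt0 b0.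
have rlt : r < (b ^ r * m).+1.
  by rewrite ltnS; apply: leq_trans (ltnW (ltn_expl r b1)) (leq_pmulr _ m0).
by apply: (leq_bigmax_cond (Ordinal rlt)); rewrite dvdn_mulr.
Qed.

Lemma last_nz_digitE (b r m : nat) :
  1 < b -> ~~ (b %| m) -> last_nz_digit b (b ^ r * m) = m %% b.
Proof.
move=> b1 ndv; rewrite /last_nz_digit base_valE // mulKn //.
by rewrite expn_gt0 (ltnW b1).
Qed.

(* Main.v *)
Require Import Defs.
From mathcomp Require Import all_boot.

(** Write [b = 2 ^ w] with [w = 2 ^ s], and [n = 2 ^ t * m] with [m] odd, so
    that [n ^ n = 2 ^ (t * n) * m ^ n].  The last non-zero digit of [2 ^ e * m']
    with [m'] odd depends only on [e] modulo [w] and on [m'] modulo [b]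
    ([last_nz_digit_pow2]).  That [w] is a power of two matters only through
    [w %| 2 ^ w = b]: hence replacing [n] by [n + b] in the exponent [t * n]
    does not change it modulo [w], and [w %| n] as soon as [b %| n].

    The odd part is controlled by one congruence: raising to the power [2 ^ t]
    improves a congruence modulo [2 ^ k], with [0 < k], to one modulo
    [2 ^ (k + t)] ([eqn_mod_exp_pow2]).  It shows that the [b]-th power of any
    odd number is [1] modulo [b].

    If [t < w], then [n + b = 2 ^ t * (m + 2 ^ (w - t))] has the same 2-adic
    valuation as [n], and the odd parts agree modulo [2 ^ (w - t)], hence their
    [n]-th powers agree modulo [2 ^ w], because [2 ^ t] divides [n]; the extra
    [b] in the exponent contributes a factor [1].  If [t >= w], then [b] divides
    both [n] and [n + b], and both digits are [1] ([frakS_dvd]). *)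

(** Each squaring gains one factor [2]: in [a ^ 2 - c ^ 2 = (a - c) * (a + c)]
    the second factor is even as soon as [a] and [c] have the same parity. *)
Lemma eqn_mod_exp_pow2 (a c k t : nat) :
  0 < k -> a = c %[mod 2 ^ k] -> a ^ 2 ^ t = c ^ 2 ^ t %[mod 2 ^ (k + t)].
Proof.
move=> k0 eq_ac; elim: t => [|t IHt]; first by rewrite addn0 !expn1.
rewrite expnSr !expnM addnS (expnSr 2 (k + t)).
move: (a ^ 2 ^ t) (c ^ 2 ^ t) IHt => x y {eq_ac}.
wlog le_yx : x y / y <= x.
  by move=> H eq_xy; case/orP: (leq_total y x) => /H ->.
move/eqP; rewrite eqn_mod_dvd // => dv_xy.
apply/eqP; rewrite eqn_mod_dvd ?leq_exp2r // subn_sqr dvdn_mul //.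
have: 2 %| x - y by apply: dvdn_trans dv_xy; rewrite dvdn_exp // addn_gt0 k0.
by rewrite !dvdn2 oddD oddB.
Qed.

(** The previous lemma applied to [m = 1 %[mod 2]]; it even gives the congruence
    modulo [2 ^ w.+1]. *)
Lemma expn_odd_pow2 (w m : nat) : odd m -> m ^ 2 ^ w = 1 %[mod 2 ^ w].
Proof.
move=> om; have eq_m1 : m = 1 %[mod 2 ^ 1] by rewrite !modn2 om.
have := eqn_mod_exp_pow2 m 1 1 w isT eq_m1; rewrite exp1n => eq1.
have dv : 2 ^ w %| 2 ^ (1 + w) by rewrite dvdn_exp2l // leq_addl.
by rewrite -(modn_dvdm (m ^ _) dv) eq1 modn_dvdm.
Qed.

(** Splitting [e = (e %/ w) * w + e %% w] isolates the full power of the base;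
    the cofactor [2 ^ (e %% w) * m] is not divisible by [2 ^ w]. *)
Lemma last_nz_digit_pow2 (w e m : nat) : 0 < w -> odd m ->
  last_nz_digit (2 ^ w) (2 ^ e * m) = (2 ^ (e %% w) * m) %% 2 ^ w.
Proof.
move=> w0 om; rewrite {1}(divn_eq e w) expnD (mulnC _ w).
rewrite expnM -mulnA last_nz_digitE //.
  by rewrite -(expn0 2) ltn_exp2l.
have cop : coprime (2 ^ w) m by rewrite coprimeXl ?coprime2n.
by rewrite Gauss_dvdl // dvdn_Pexp2l // -ltnNge ltn_mod.
Qed.

Lemma frakS_pow2 (w t m : nat) : 0 < w -> odd m -> let n := 2 ^ t * m in
  frakS (2 ^ w) n = (2 ^ ((t * n) %% w) * m ^ n) %% 2 ^ w.
Proof.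
move=> w0 om n; rewrite /frakS {1}/n expnMn -expnM last_nz_digit_pow2 //.
by rewrite oddX om orbT.
Qed.

(** Here [w %| 2 ^ w %| n], so [n ^ n] is a power of [2 ^ w] times the [n]-th
    power of an odd number, and that power is [1] modulo [2 ^ w]. *)
Lemma frakS_dvd (w n : nat) :
  0 < w -> w %| 2 ^ w -> 0 < n -> 2 ^ w %| n -> frakS (2 ^ w) n = 1.
Proof.
move=> w0 dv_w n0 dv_n.
have [m om Dn] := pfactor_coprime (p := 2) isT n0.
rewrite coprime2n in om; rewrite mulnC in Dn.
have := frakS_pow2 w (logn 2 n) m w0 om; rewrite /= -Dn => ->.
have /eqP-> : (logn 2 n * n) %% w == 0.
  by rewrite -/(w %| _) dvdn_mull // (dvdn_trans dv_w).
rewrite mul1n; case/dvdnP: dv_n => q ->.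
rewrite expnM expn_odd_pow2 ?oddX ?om ?orbT //.
by rewrite modn_small // -{1}(expn0 2) ltn_exp2l.
Qed.

Theorem proposition10 (b s : nat) (hb : b = 2 ^ (2 ^ s)) (n : nat) (hn : 0 < n) :
  frakS b n = frakS b (n + b).
Proof.
move: hb; set w := 2 ^ s => ->{b}.
have w0 : 0 < w by rewrite expn_gt0.
have dv_w : w %| 2 ^ w by rewrite dvdn_exp2l // ltnW // ltn_expl.
have [dv_n | ndv_n] := boolP (2 ^ w %| n).
  by rewrite !frakS_dvd ?dvdn_addl ?addn_gt0 ?hn.
have [m om Dn] := pfactor_coprime (p := 2) isT hn.
rewrite coprime2n in om; rewrite mulnC in Dn.
rewrite pfactor_dvdn // -ltnNge in ndv_n.
move: (logn 2 n) ndv_n Dn => t lt_tw Dn.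
pose m' := m + 2 ^ (w - t).
have om' : odd m' by rewrite /m' oddD om oddX subn_eq0 leqNgt lt_tw.
have DN : n + 2 ^ w = 2 ^ t * m'.
  by rewrite mulnDr -Dn -expnD subnKC // ltnW.
have /= := frakS_pow2 w t m w0 om; rewrite -Dn => ->.
have /= := frakS_pow2 w t m' w0 om'; rewrite -DN => ->.
have -> : (t * (n + 2 ^ w)) %% w = (t * n) %% w.
  by rewrite mulnDr -modnDmr (eqP (dvdn_mull t dv_w)) addn0.
rewrite -[LHS]modnMmr -[RHS]modnMmr; congr ((_ * _) %% _).
rewrite expnD -modnMmr (expn_odd_pow2 w m' om') modnMmr muln1.
(* [2 ^ t] divides the exponent [n], which lifts [m = m'] from modulo
   [2 ^ (w - t)] to modulo [2 ^ w]. *)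
have eq_m : m = m' %[mod 2 ^ (w - t)] by rewrite modnDr.
have := eqn_mod_exp_pow2 m m' (w - t) t; rewrite subn_gt0 subnK ?(ltnW lt_tw) //.
move=> /(_ lt_tw eq_m) eq_mt.
by rewrite Dn !expnM -[LHS]modnXm eq_mt modnXm.
Qed.
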